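(* Let $R_n$ be any bounded relaxation of $\mathrm{QAP}_n$ (a polytope in $\mathbb{R}^{n^2\times n^2}$ containing $\mathrm{QAP}_n$) such that all inequalities $$\sum_{i,j,k,l\in[n]}n_{ij}n_{kl}Y_{ij,kl}-(2\beta-1)\sum_{i,j\in[n]}n_{ij}Y_{ij,ij}\geqslant\frac14-\left(\beta-\frac12\right)^2,$$ for all $\beta\in\mathbb{Z}$ and all $n_{ij}\in\mathbb{Z}$ ($i,j\in[n]$), are valid for $R_n$. Then $\mathrm{xc}(R_n)\geqslant 2^{\Omega(n)}$.
   Context: $P_\sigma$ is the $n\times n$ permutation matrix of $\sigma\in S_n$ ($P_\sigma(i,j)=1$ iff $\sigma(i)=j$). Matrices in $\mathbb{R}^{n^2\times n^2}$ have rows and columns indexed by pairs $(ij)$, $i,j\in[n]$; $Y_{ij,kl}$ is the entry in row $(ij)$, column $(kl)$. $P^{[2]}_\sigma(ij,kl)=P_\sigma(i,j)P_\sigma(k,l)$ and $\mathrm{QAP}_n=\mathrm{conv}\{P^{[2]}_\sigma:\sigma\in S_n\}$. A polytope $Q\subset\mathbb{R}^{d+r}$ is an extension of a polytope $P\subset\mathbb{R}^d$ if $P=\{x:\exists y,\ (x,y)\in Q\}$; the extension complexity $\mathrm{xc}(P)$ is the minimum number of facets of an extension of $P$. *)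

(* Defs.v *)
From HB Require Import structures.
From mathcomp Require Export all_boot all_order all_fingroup all_algebra.
From mathcomp Require Export all_classical all_reals exp.

Set Implicit Arguments.
Unset Strict Implicit.
Unset Printing Implicit Defensive.

Import Order.TTheory GRing.Theory Num.Theory.

#[global] Open Scope classical_set_scope.
#[global] Open Scope ring_scope.

Section Polytopes.
Variables (R : realType) (V : vectType R).
Implicit Types (S P F : set V).

Definition conv S : set V :=
  [set x | exists (k : nat) (p : 'I_k -> V) (w : 'I_k -> R),
     [/\ forall i, S (p i),
         forall i, 0 <= w i,
         \sum_i w i = 1
       & x = \sum_i w i *: p i]].

Definition polytope P : Prop := exists s : seq V, P = conv [set` s].

Definition face P F : Prop :=
  exists (f : {scalar V}) (b : R),
    (forall x, P x -> f x <= b) /\ F = P `&` [set x | f x = b].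

(* k + 1 affinely independent points in S: x0 and the k elements of s *)
Definition has_affindep S (k : nat) : Prop :=
  exists (x0 : V) (s : seq V),
    [/\ S x0, forall x, x \in s -> S x, size s = k
      & free [seq x - x0 | x <- s]].

Definition has_dim S (k : nat) : Prop :=
  has_affindep S k /\ ~ has_affindep S k.+1.

(* The empty face has no dimension in the sense of has_dim, so a polytope
   reduced to a point has no facet. *)
Definition facet P F : Prop :=
  face P F /\ exists k : nat, has_dim P k.+1 /\ has_dim F k.

Definition nb_facets P (k : nat) : Prop := ([set F | facet P F] #= `I_k)%card.

End Polytopes.

Section ExtensionComplexity.
Variables (R : realType) (V : vectType R).
Implicit Type P : set V.

(* The ambient space R^{d+r} of an extension is V * R^r. *)
Definition extension P (r : nat) (Q : set (V * 'rV[R]_r)%type) : Prop :=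
  polytope Q /\ P = [set x | exists y, Q (x, y)].

Definition extension_sizes P : set nat :=
  [set k | exists (r : nat) (Q : set (V * 'rV[R]_r)%type),
     extension P Q /\ nb_facets Q k].

(* The least element of extension_sizes P; the default 0 is only used when P
   has no extension, hence never for a polytope P. *)
Definition xc P : nat :=
  xget 0%N [set k | extension_sizes P k
                    /\ forall m, extension_sizes P m -> (k <= m)%N].

End ExtensionComplexity.

Section QAP.
Variables (R : realType) (n : nat).

(* Position in [n^2] of the pair (ij). *)
Definition pr (i j : 'I_n) : 'I_(n * n) := mxvec_index i j.

(* mxvec A 0 (pr i j) = A i j, so the entry in row pr i j and column pr k l is
   P_s(i,j) P_s(k,l); and perm_mx s i j = (s i == j)%:R. *)
Definition perm_sq (s : 'S_n) : 'M[R]_(n * n) :=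
  \matrix_(p, q) (mxvec (perm_mx s) 0 p * mxvec (perm_mx s) 0 q).

Definition QAP : set 'M[R]_(n * n) := conv (range perm_sq).

Definition qap_ineq (beta : int) (N : 'I_n -> 'I_n -> int)
    (Y : 'M[R]_(n * n)) : Prop :=
  \sum_(i < n) \sum_(j < n) \sum_(k < n) \sum_(l < n)
      (N i j)%:~R * (N k l)%:~R * Y (pr i j) (pr k l)
  - (2 * beta%:~R - 1)
      * (\sum_(i < n) \sum_(j < n) (N i j)%:~R * Y (pr i j) (pr i j))
  >= 4^-1 - (beta%:~R - 2^-1) ^+ 2.

End QAP.

Arguments perm_sq R n s : clear implicits.
Arguments QAP R n : clear implicits.

(* Main.v *)
From HB Require Import structures.
Require Import Defs.
From mathcomp Require Import zify ring lra.

Set Implicit Arguments.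
Unset Strict Implicit.
Unset Printing Implicit Defensive.

Import Order.TTheory GRing.Theory Num.Theory.

(** For a permutation s, put x = \sum_i N_{i,s(i)}; the slack of the inequality
    at the vertex of s is (x - beta)(x - beta + 1). Let m = n/2. To b included in
    [m] associate the permutation exchanging i and m + i for i in b, and to a
    included in [m] the inequality with beta = 2 and N_{i,m+i} = 1 for i in a.
    Then x = #|a :&: b|, so the slack (x - 1)(x - 2) is nonzero when a and b are
    disjoint and zero when they meet in exactly one element.

    Lift the vertices to an extension Q. The points of Q at which the inequality
    of a (nonempty) is tight form a nonempty face G_a. A point of Q outside G_a is
    separated from it by a facet: a face containing G_a, avoiding the point and
    maximal for these properties is a facet, since otherwise its hyperplane could
    be rotated further. Hence the rectangles {a | G_a included in F} x
    {b | y_b not in F}, F a facet, cover all disjoint pairs with a nonempty and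
    contain no pair with #|a :&: b| = 1. By the argument of Kaibel and Weltge such
    a rectangle contains at most 2^m of the 3^m disjoint pairs. *)

(** * Covers of the disjoint pairs by rectangles *)

(* Subsets of [m] are encoded as their indicator sequences, of size m. *)
Fixpoint disjoint_pairs (m : nat) : seq (seq bool * seq bool) :=
  if m is m'.+1 then
    [seq (false :: p.1, false :: p.2) | p <- disjoint_pairs m']
    ++ [seq (true :: p.1, false :: p.2) | p <- disjoint_pairs m']
    ++ [seq (false :: p.1, true :: p.2) | p <- disjoint_pairs m']
  else [:: ([::], [::])].

Definition card_meet (a b : seq bool) : nat :=
  count (fun p => p.1 && p.2) (zip a b).

Lemma size_disjoint_pairs m : size (disjoint_pairs m) = (3 ^ m)%N.
Proof.
elim: m => //= m IH; rewrite !size_cat !size_map IH expnS; lia.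
Qed.

Lemma mem_disjoint_pairs m p : p \in disjoint_pairs m ->
  [/\ size p.1 = m, size p.2 = m & card_meet p.1 p.2 = 0%N].
Proof.
elim: m p => [|m IH] p /=; first by rewrite inE => /eqP->.
by rewrite !mem_cat => /or3P[] /mapP[q /IH[/= s1 s2 q0] ->] /=;
  rewrite s1 s2.
Qed.

Definition rect (A B : pred (seq bool)) := [pred p | A p.1 && B p.2].

(* Split on the first coordinate: of the three extensions of a disjoint pair
   to a disjoint pair, at most two lie in the rectangle, since otherwise it
   would contain a pair meeting exactly there. *)
Lemma count_disjoint_pairs_rect m (A B : pred (seq bool)) :
  (forall a b, size a = m -> size b = m -> A a -> B b -> card_meet a b != 1%N) ->
  (count (rect A B) (disjoint_pairs m) <= 2 ^ m)%N.
Proof.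
elim: m A B => [|m IH] A B AB /=.
  by rewrite addn0; case: (_ && _).
rewrite !count_cat !count_map expnS mul2n -addnn.
pose A0 := [pred a | A (false :: a)]; pose A1 := [pred a | A (true :: a)].
pose B0 := [pred b | B (false :: b)]; pose B1 := [pred b | B (true :: b)].
(* A pair whose first entries are not both [true] meets as often as its tail. Over a disjoint tail,
   the number of extensions lying in [rect A B] is at most the number of these two rectangles
   containing the tail. *)
have H1 : (count (rect (predU A0 A1) B0) (disjoint_pairs m) <= 2 ^ m)%N.
  by apply: IH => a b sa sb /orP[] Aa Bb; have := AB _ _ _ _ Aa Bb;
    rewrite /= sa sb; apply.
have H2 : (count (rect A0 (predU B0 B1)) (disjoint_pairs m) <= 2 ^ m)%N.
  by apply: IH => a b sa sb Aa /orP[] Bb; have := AB _ _ _ _ Aa Bb;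
    rewrite /= sa sb; apply.
apply: leq_trans (leq_add H1 H2); rewrite {H1 H2}.
set s := disjoint_pairs m.
have {AB} : forall p, p \in s -> ~~ (A1 p.1 && B1 p.2).
  move=> p /mem_disjoint_pairs[s1 s2 p0]; apply/negP => /andP[Ap Bp].
  by have := AB _ _ _ _ Ap Bp; rewrite /= s1 s2 /card_meet /= -/(card_meet _ _)
    p0 => /(_ erefl erefl).
elim: s => //= p s IHs ps.
have := ps p (mem_head _ _).
have /IHs : forall q, q \in s -> ~~ (A1 q.1 && B1 q.2).
  by move=> q qs; apply: ps; rewrite inE qs orbT.
rewrite /preim /= /A0 /A1 /B0 /B1 /=.
case: (A (false :: _)); case: (A (true :: _)); case: (B (false :: _));
  case: (B (true :: _)) => //=; lia.
Qed.

(** Union bound: each rectangle holds at most 2^m of the 3^m disjoint pairs. *)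
Lemma disjoint_pairs_cover m k (A B : 'I_k -> pred (seq bool)) :
  (forall i a b, size a = m -> size b = m -> A i a -> B i b ->
     card_meet a b != 1%N) ->
  (forall a b, size a = m -> size b = m -> card_meet a b = 0%N ->
     exists i, A i a && B i b) ->
  (3 ^ m <= k * 2 ^ m)%N.
Proof.
move=> AB cov; rewrite -size_disjoint_pairs.
have -> : (k * 2 ^ m = \sum_(i < k) 2 ^ m)%N by rewrite sum_nat_const card_ord.
apply: leq_trans (leq_sum _ (fun i _ => count_disjoint_pairs_rect (AB i))).
have {cov} : forall p, p \in disjoint_pairs m -> exists i, rect (A i) (B i) p.
  by move=> p /mem_disjoint_pairs[? ? ?]; apply: cov.
elim: (disjoint_pairs m) => //= p s IHs ps; rewrite big_split /= -add1n.
apply: leq_add; last by apply: IHs => q qs; apply: ps; rewrite inE qs orbT.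
have [i ip] := ps p (mem_head _ _).
by rewrite (bigD1 i) //= ip; lia.
Qed.

(** Taking for [b] the first element of [a] suffices; this provides a point on the face attached to
    [a]. *)
Lemma exists_card_meet1 a : has id a ->
  exists2 b, size b = size a & card_meet a b = 1%N.
Proof.
elim: a => //= -[] a IH /=.
  exists (true :: nseq (size a) false); first by rewrite /= size_nseq.
  rewrite /card_meet /= -[RHS]addn0; congr (_ + _)%N.
  by elim: a {IH} => //= x a ->; rewrite andbF.
by move=> /IH[b sb ab]; exists (false :: b); rewrite //= sb.
Qed.

Lemma card_meet0 a b : ~~ has id a -> card_meet a b = 0%N.
Proof.
elim: a b => [[]|x a IH [|y b]] //=.
rewrite negb_or => /andP[/negbTE-> /IH]; exact.
Qed.

Lemma count_lt_sub (T : eqType) (a1 a2 : pred T) (s : seq T) v :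
  subpred a1 a2 -> v \in s -> a2 v -> ~~ a1 v -> (count a1 s < count a2 s)%N.
Proof.
move=> a12 vs a2v a1v.
have le : (count (predU a1 (pred1 v)) s <= count a2 s)%N.
  by apply: sub_count => u /= /orP[/a12|/eqP->].
apply: leq_trans le; have := count_predUI a1 (pred1 v) s.
have -> : count (predI a1 (pred1 v)) s = 0%N.
  apply/eqP; rewrite -leqn0 leqNgt -has_count; apply/hasPn => u _ /=.
  by apply: contra a1v => /andP[au /eqP <-].
rewrite addn0 => ->; rewrite -[X in (X < _)%N]addn0 ltn_add2l -has_count.
by apply/hasP; exists v => //=.
Qed.

(** * Faces of polytopes and separation by facets *)

Section Faces.
Variables (R : realType) (V : vectType R).
Implicit Types (P F G S : set V) (s : seq V).

Lemma scalar_ex (g : V -> R) :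
  (forall a x y, g (a *: x + y) = a * g x + g y) ->
  exists f : {scalar V}, f =1 g.
Proof.
move=> lin_g.
pose g_lin := GRing.isLinear.Build R V R *%R g lin_g.
pose f : {scalar V} := HB.pack g g_lin.
by exists f.
Qed.

(** [f] reads a coordinate of [x - projv U x], chosen to be nonzero at [v]. *)
Lemma separate_vspace (U : {vspace V}) v : v \notin U ->
  exists f : {scalar V}, (forall u, u \in U -> f u = 0) /\ f v != 0.
Proof.
move=> vU; have /existsP[i hi] :
    [exists i, coord (vbasis fullv) i (v - projv U v) != 0].
  apply: contraNT vU; rewrite negb_exists => /forallP h.
  have : v - projv U v = 0.
    rewrite (coord_vbasis (memvf (v - projv U v))) big1// => i _.
    by have := h i; rewrite negbK => /eqP ->; rewrite scale0r.
  by move/eqP; rewrite subr_eq0 => /eqP ->; exact: memv_proj.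
have [|f fE] := @scalar_ex (fun x => coord (vbasis fullv) i (x - projv U x)).
  move=> a x y; rewrite -linearZ -linearD; congr coord.
  by rewrite linearP scalerBr opprD addrACA.
exists f; split=> [u uU|]; last by rewrite fE.
by rewrite fE projv_id // subrr linear0.
Qed.

Lemma not_has_affindep S x0 (U : {vspace V}) :
  (forall y, S y -> y - x0 \in U) -> ~ has_affindep S (\dim U).+1.
Proof.
move=> SU [y0 [s [Sy0 Ss ss fs]]].
have := dimvS (U := <<[seq x - y0 | x <- s]>>%VS) (V := U).
rewrite (eqP fs) size_map ss ltnn => nsub; suff /nsub : (<<[seq x - y0 | x <- s]>> <= U)%VS by [].
apply/span_subvP => _ /mapP[x xs ->].
have -> : x - y0 = (x - x0) - (y0 - x0) by rewrite opprB addrA subrK.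
by apply: rpredB; apply: SU => //; exact: Ss.
Qed.

Lemma has_affindepS S x0 s x :
  S x0 -> (forall y, y \in s -> S y) -> free [seq y - x0 | y <- s] ->
  S x -> x - x0 \notin <<[seq y - x0 | y <- s]>>%VS ->
  has_affindep S (size s).+1.
Proof.
move=> Sx0 Ss fs Sx xs; exists x0, (x :: s).
split=> //= [y|]; last by rewrite free_cons xs.
by rewrite inE => /predU1P[->//|/Ss].
Qed.

(** In an affinely independent family of maximal size, a point outside the span would extend the
    family. *)
Lemma affindep_span_ex S : S !=set0 ->
  exists x0 s, [/\ S x0, forall y, y \in s -> S y, free [seq y - x0 | y <- s]
    & forall y, S y -> y - x0 \in <<[seq y - x0 | y <- s]>>%VS].
Proof.
move=> [z Sz].
have ex0 : exists k, `[< has_affindep S k >].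
  by exists 0%N; apply/asboolP; exists z, [::]; split => //=; rewrite nil_free.
have ub k : `[< has_affindep S k >] -> (k <= \dim (fullv : {vspace V}))%N.
  move=> /asboolP[x0 [s [_ _ <- fs]]].
  by rewrite -(size_map (fun x => x - x0)) -(eqP fs) dimvS // subvf.
case: (ex_maxnP ex0 ub) => k /asboolP[x0 [s [Sx0 Ss ss fs]]] maxk.
exists x0, s; split => // y Sy; apply: contraT => ys.
by have /asboolP/maxk := has_affindepS Sx0 Ss fs Sy ys; rewrite ss ltnn.
Qed.

Lemma mem_conv S x : S x -> conv S x.
Proof.
move=> Sx; exists 1%N, (fun=> x), (fun=> 1).
by split=> //; rewrite big_ord1 // scale1r.
Qed.

Lemma conv_le S (f : {scalar V}) b :
  (forall p, S p -> f p <= b) -> forall x, conv S x -> f x <= b.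
Proof.
move=> Sb _ [k [p [w [Sp w0 w1 ->]]]]; rewrite linear_sum -[b]mul1r -w1 mulr_suml.
by apply: ler_sum => i _; rewrite linearZ ler_wpM2l // Sb.
Qed.

(** The weighted gaps [w i * (b - f (p i))] are nonnegative and add up to the gap of the
    combination. *)
Lemma conv_eqP (k : nat) (p : 'I_k -> V) (w : 'I_k -> R) (f : {scalar V}) b :
  (forall i, 0 <= w i) -> \sum_i w i = 1 -> (forall i, f (p i) <= b) ->
  f (\sum_i w i *: p i) = b <-> forall i, w i != 0 -> f (p i) = b.
Proof.
move=> w0 w1 pb; split=> [fb i wi|fb]; last first.
  rewrite linear_sum -[b]mul1r -w1 mulr_suml; apply: eq_bigr => i _.
  by rewrite linearZ /=; have [->|/fb->//] := eqVneq (w i) 0; rewrite !mul0r.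
have : \sum_i w i * (b - f (p i)) = 0.
  under eq_bigr do rewrite mulrBr.
  rewrite sumrB -mulr_suml w1 mul1r -{1}fb linear_sum.
  by apply/eqP; rewrite subr_eq0; apply/eqP/eq_bigr => j _; rewrite linearZ.
move/eqP; rewrite psumr_eq0 => [|j _]; last by rewrite mulr_ge0 // subr_ge0.
move=> /allP /(_ i (mem_index_enum _)) /=.
by rewrite mulf_eq0 (negbTE wi) /= subr_eq0 => /eqP.
Qed.

(** By [conv_eqP], a point of a face is a combination of generators lying in that face. *)
Lemma face_trace_sub s F F' : face (conv [set` s]) F -> face (conv [set` s]) F' ->
  (forall p, p \in s -> F p -> F' p) -> F `<=` F'.
Proof.
move=> [f [b [fb ->]]] [f' [b' [fb' ->]]] ss' x /= [Px fx]; split=> //.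
case: Px fx => k [p [w [sp w0 w1 ->]]] fx.
have lef i : f (p i) <= b by apply/fb/mem_conv/sp.
have lef' i : f' (p i) <= b' by apply/fb'/mem_conv/sp.
apply/(conv_eqP w0 w1 lef') => i wi.
have fpi : f (p i) = b by exact: (conv_eqP w0 w1 lef).1.
by have [] := ss' _ (sp i) (conj (mem_conv (sp i)) fpi).
Qed.

Lemma finite_faces P : polytope P -> finite_set [set F | face P F].
Proof.
move=> [s ->].
(* By [face_trace_sub] a face is determined by its generators; [g] recovers it from their
   indices. *)
pose g (T : {set 'I_(size s)}) : set V := [set x | exists2 F,
  face (conv [set` s]) F /\ T = [set i : 'I_(size s) | `[< F s`_i >]]%SET & F x].
apply: (@sub_finite_set _ _ (g @` setT)); last exact/finite_image/finite_finset.
move=> F /= faceF; exists [set i : 'I_(size s) | `[< F s`_i >]]%SET => //.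
apply/seteqP; split=> x /=; last by move=> Fx; exists F.
case=> F' [faceF' FF']; apply: (@face_trace_sub s) => // p ps.
have ip : (index p s < size s)%N by rewrite index_mem.
have /setP/(_ (Ordinal ip)) := FF'; rewrite !inE /= nth_index // => FF'p.
by move=> F'p; apply/asboolP; rewrite FF'p; apply/asboolP.
Qed.

Lemma scalar_span_eq0 (f : {scalar V}) (X : seq V) v :
  (forall u, u \in X -> f u = 0) -> v \in <<X>>%VS -> f v = 0.
Proof.
move=> fX /(@coord_span _ _ _ (in_tuple X)) ->.
by rewrite linear_sum big1 // => i _; rewrite linearZ /= fX ?mulr0 // mem_nth.
Qed.

(* The hyperplane of F is rotated about F, in the direction of h, until it hits
   a new generator; it stays away from x because h vanishes there. *)
Lemma tilt_face s F x0 x (h : {scalar V}) p :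
  face (conv [set` s]) F -> F x0 -> conv [set` s] x -> ~ F x ->
  (forall y, F y -> h (y - x0) = 0) -> h (x - x0) = 0 ->
  p \in s -> h (p - x0) != 0 ->
  exists F', [/\ face (conv [set` s]) F', F `<=` F', ~ F' x
    & exists v, [/\ v \in s, F' v & ~ F v]].
Proof.
set P := conv _; move=> [f [b [fb FE]]] Fx0 Px nFx hF hx ps.
wlog hp : h hF hx / 0 < h (p - x0) => [wl|_].
  rewrite neq_lt => /orP[hp|hp]; last by apply: (wl h) => //; rewrite gt_eqF.
  have [|h' h'E] := @scalar_ex (fun y => - h y).
    by move=> a y z; rewrite linearP /= opprD mulrN.
  by apply: (wl h'); rewrite ?h'E ?oppr_gt0 ?oppr_eq0 ?hx ?oppr0 ?lt_eqF // => y
    Fy; rewrite h'E hF // oppr0.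
have sP q : q \in s -> P q by move=> qs; apply: mem_conv.
have fs q : q \in s -> f q <= b by move=> /sP/fb.
have ip : (index p s < size s)%N by rewrite index_mem.
pose r (i : 'I_(size s)) := (b - f s`_i) / h (s`_i - x0).
have hip : 0 < h (s`_(Ordinal ip) - x0) by rewrite /= nth_index.
case: (@Order.TotalTheory.arg_minP _ _ _ (Ordinal ip)
  (fun i => 0 < h (s`_i - x0)) r hip) => i hi mini.
set t := r i in mini.
have is_ : s`_i \in s by rewrite mem_nth.
have t0 : 0 <= t by rewrite /t /r divr_ge0 ?(ltW hi) // subr_ge0 fs.
have [|f' f'E] := @scalar_ex (fun y => f y + t * h y).
  by move=> a y z; rewrite !linearP /=; ring.
have fx0 : f x0 = b by move: Fx0; rewrite FE => -[].
have f'b y : f' y - (b + t * h x0) = (f y - b) + t * h (y - x0).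
  by rewrite f'E linearB /=; ring.
have f'_le y : P y -> f' y <= b + t * h x0.
  apply: conv_le => q qs; rewrite -subr_le0 f'b.
  have [hq|hq] := ltP 0 (h (q - x0)); last first.
    by rewrite -[leRHS]addr0 lerD ?subr_le0 ?fs // mulr_ge0_le0.
  have iq : (index q s < size s)%N by rewrite index_mem.
  have := mini (Ordinal iq); rewrite /r /= nth_index // ler_pdivlMr // => /(_ hq).
  by lra.
exists (P `&` [set y | f' y = b + t * h x0]); split.
- by exists f', (b + t * h x0).
- move=> y Fy; have hy := hF _ Fy; move: Fy; rewrite FE => -[Py /= fy]; split=> //.
  by apply/eqP; rewrite -subr_eq0 f'b hy fy; apply/eqP; ring.
- move=> [_ /= /eqP]; rewrite -subr_eq0 f'b hx mulr0 addr0 subr_eq0 => /eqP fx.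
  by apply: nFx; rewrite FE.
exists s`_i; split=> //.
  split; first exact: sP.
  apply/eqP; rewrite -subr_eq0 f'b /t /r (mulfVK (negbT (gt_eqF hi))).
  by rewrite -(opprB b) addNr eqxx.
by move=> /hF hi0; rewrite hi0 ltxx in hi.
Qed.

Lemma facet_separation P G x : polytope P -> face P G -> G !=set0 ->
  P x -> ~ G x -> exists F, [/\ facet P F, G `<=` F & ~ F x].
Proof.
move=> [s PE] faceG [z Gz] Px nGx.
pose sep F := [/\ face P F, G `<=` F & ~ F x].
(* Maximality is measured by the number of generators in the face. *)
pose cnt F := count (fun p => `[< F p >]) s.
have ex0 : exists k, `[< exists2 F, sep F & cnt F = k >].
  by exists (cnt G); apply/asboolP; exists G => //; split.
have ub k : `[< exists2 F, sep F & cnt F = k >] -> (k <= size s)%N.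
  by move=> /asboolP[F _ <-]; exact: count_size.
case: (ex_maxnP ex0 ub) => k /asboolP[F [faceF GF nFx] cntF] maxk.
exists F; split=> //; split=> //.
have [x0 [t [Fx0 Ft freet spant]]] :=
  affindep_span_ex (ex_intro _ z (GF _ Gz)).
have FP : F `<=` P by case: faceF => f [b [_ ->]] y [].
set T := map _ _ in freet spant.
have xT : x - x0 \notin <<T>>%VS.
  case: (faceF) => f [b [fb FE]].
  apply: contra_notN nFx => xT; rewrite FE; split=> //=.
  have fF y : F y -> f y = b by rewrite FE => -[].
  have /eqP : f (x - x0) = 0.
    apply: scalar_span_eq0 xT => _ /mapP[y yt ->].
    by rewrite linearB /= !fF ?subrr //; exact: Ft.
  by rewrite linearB /= subr_eq0 (fF x0) // => /eqP.
have freexT : free (x - x0 :: T) by rewrite free_cons xT.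
(* A generator outside the affine span of [F] and [x] would let [tilt_face] enlarge [F]; hence [P]
   has dimension one more than [F]. *)
have sW p : p \in s -> p - x0 \in <<x - x0 :: T>>%VS.
  move=> ps; apply: contraT => /separate_vspace[h [hW hp]].
  have TW y : y \in <<T>>%VS -> y \in <<x - x0 :: T>>%VS.
    by move=> yT; rewrite span_cons; apply: subvP yT; exact: addvSr.
  have [||||F' [faceF' FF' nF'x [v [vs F'v nFv]]]] :=
    @tilt_face s F x0 x h p _ Fx0 _ nFx _ _ ps hp; rewrite -?PE //.
  - by move=> y Fy; apply/hW/TW/spant.
  - by apply/hW/memv_span/mem_head.
  have /asboolP/maxk : exists2 F, sep F & cnt F = cnt F'.
    by exists F' => //; split; rewrite ?PE //; exact: subset_trans FF'.
  rewrite -cntF leqNgt => /negP[]; apply: (@count_lt_sub _ _ _ _ v) => //.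
  - by move=> y /= /asboolP Fy; apply/asboolP/FF'.
  - exact/asboolP.
  - exact/asboolPn.
exists (size t); split; split.
- by apply: (@has_affindepS P x0 t x) => //; [exact: FP|move=> y /Ft/FP].
- have := @not_has_affindep P x0 <<x - x0 :: T>>%VS.
  rewrite (eqP freexT) /= size_map; apply => y; rewrite PE.
  move=> [l [p [w [sp w0 w1 ->]]]].
  rewrite -[X in _ - X \in _]scale1r -w1 scaler_suml -sumrB rpred_sum // => i _.
  by rewrite -scalerBr; apply/memvZ/sW/sp.
- by exists x0, t.
- have := @not_has_affindep F x0 <<T>>%VS.
  by rewrite (eqP freet) size_map; apply.
Qed.

Lemma face_max P (f : {scalar V}) b :
  (forall x, P x -> f x <= b) -> face P (P `&` [set x | f x = b]).
Proof. by move=> fb; exists f, b. Qed.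

Lemma finite_nb_facets P : polytope P -> exists k, nb_facets P k.
Proof.
move=> /finite_faces fin.
by apply: (sub_finite_set _ fin) => F [].
Qed.

End Faces.

(** * Attainment of the extension complexity *)

Lemma extension_sizes_ex (R : realType) (V : vectType R) (P : set V) :
  polytope P -> exists k, extension_sizes P k.
Proof.
(* [P] is an extension of itself, with [r = 0]. *)
move=> [s PE]; pose s0 := [seq (x, 0 : 'rV[R]_0) | x <- s].
have polyQ : polytope (conv [set` s0]) by exists s0.
have [k nbQ] := finite_nb_facets polyQ.
exists k, 0%N, (conv [set` s0]); split=> //; split=> //.
have fst_sum l (w : 'I_l -> R) (p : 'I_l -> V * 'rV[R]_0) :
    (\sum_i w i *: p i).1 = \sum_i w i *: (p i).1.
  by rewrite (raddf_sum fst).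
rewrite PE; apply/seteqP; split=> x /=.
  move=> [l [p [w [sp w0 w1 ->]]]].
  exists (\sum_i w i *: ((p i, 0) : V * 'rV[R]_0)).2.
  exists l, (fun i => (p i, 0)), w; split=> //.
    by move=> i; apply/mapP; exists (p i) => //; exact: sp.
  by rewrite [RHS]surjective_pairing fst_sum.
move=> [y [l [p [w [sp w0 w1 xyE]]]]].
exists l, (fun i => (p i).1), w; split=> //.
  by move=> i; have /mapP[q qs ->] := sp i.
by rewrite -fst_sum -xyE.
Qed.

Lemma xcP (R : realType) (V : vectType R) (P : set V) :
  polytope P -> extension_sizes P (xc P).
Proof.
move=> /extension_sizes_ex[k0 Pk0].
have ex0 : exists k, `[< extension_sizes P k >] by exists k0; apply/asboolP.
case: (ex_minnP ex0) => k /asboolP Pk mink.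
rewrite /xc; suff /(xgetPex 0%N)[] : exists k, extension_sizes P k /\
  forall m, extension_sizes P m -> (k <= m)%N by [].
by exists k; split=> // m Pm; apply/mink/asboolP.
Qed.

(** * Permutations attached to subsets *)

(* For each i < m in the set b, exchanges i and i + m. *)
Definition swap_nat m (b : seq bool) (j : nat) : nat :=
  if nth false b j then (j + m)%N
  else if (m <= j)%N && nth false b (j - m) then (j - m)%N else j.

Lemma swap_natK m b : size b = m -> involutive (swap_nat m b).
Proof.
move=> sb j; rewrite {2}/swap_nat.
case bj: (nth false b j).
  (* [j + m] is past the end of [b], so the first test reads the default [false]. *)
  by rewrite /swap_nat addnK leq_addl bj nth_default // sb leq_addl.
case: ifP => [/andP[mj bjm]|njm].
  by rewrite /swap_nat bjm subnK.
by rewrite /swap_nat bj njm.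
Qed.

Lemma swap_nat_lt m n b j : size b = m -> (m + m <= n)%N -> (j < n)%N ->
  (swap_nat m b j < n)%N.
Proof.
rewrite /swap_nat => sb mn jn; case bj: (nth false b j); last by case: ifP; lia.
have : (j < m)%N by rewrite -sb ltnNge; apply: contraTN bj => /(nth_default false)->.
lia.
Qed.

Lemma swap_perm_ex m n b : size b = m -> (m + m <= n)%N ->
  exists s : 'S_n, forall j, s j = swap_nat m b j :> nat.
Proof.
move=> sb mn; pose f (j : 'I_n) := Ordinal (swap_nat_lt sb mn (ltn_ord j)).
have fK : involutive f by move=> j; apply/val_inj; exact: swap_natK.
by exists (perm (inv_inj fK)) => j; rewrite permE.
Qed.

Lemma card_meetE n a b : (size a <= n)%N -> size b = size a ->
  (\sum_(i < n) (nth false a i && nth false b i) = card_meet a b)%N.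
Proof.
elim: a n b => [|x a IH] n [|y b] //=.
  by move=> _ _; rewrite big1 // => i _; rewrite nth_nil.
case: n => // n /= an [sb]; rewrite big_ord_recl /= /card_meet /= -/(card_meet _ _).
by rewrite -(IH n).
Qed.

(** * The inequalities at the vertices *)

Section QapInequalities.
Variables (R : realType) (n : nat).
Implicit Types (beta : int) (N : 'I_n -> 'I_n -> int) (Y : 'M[R]_(n * n)).

Definition qap_lhs beta N Y : R :=
  \sum_(i < n) \sum_(j < n) \sum_(k < n) \sum_(l < n)
      (N i j)%:~R * (N k l)%:~R * Y (pr i j) (pr k l)
  - (2 * beta%:~R - 1)
      * (\sum_(i < n) \sum_(j < n) (N i j)%:~R * Y (pr i j) (pr i j)).

Lemma sum_linear (I : finType) (F G H : I -> R) a :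
  (forall i, H i = a * F i + G i) ->
  \sum_i H i = a * \sum_i F i + \sum_i G i.
Proof. by move=> HE; rewrite mulr_sumr -big_split; apply: eq_bigr. Qed.

Lemma qap_lhs_linear beta N a Y Z :
  qap_lhs beta N (a *: Y + Z) = a * qap_lhs beta N Y + qap_lhs beta N Z.
Proof.
rewrite /qap_lhs.
have -> : \sum_(i < n) \sum_(j < n) (N i j)%:~R * (a *: Y + Z) (pr i j) (pr i j) =
    a * (\sum_(i < n) \sum_(j < n) (N i j)%:~R * Y (pr i j) (pr i j)) +
    \sum_(i < n) \sum_(j < n) (N i j)%:~R * Z (pr i j) (pr i j).
  by do 2 apply: sum_linear => ?; rewrite !mxE; ring.
have -> : \sum_(i < n) \sum_(j < n) \sum_(k < n) \sum_(l < n)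
      (N i j)%:~R * (N k l)%:~R * (a *: Y + Z) (pr i j) (pr k l) =
    a * (\sum_(i < n) \sum_(j < n) \sum_(k < n) \sum_(l < n)
      (N i j)%:~R * (N k l)%:~R * Y (pr i j) (pr k l)) +
    \sum_(i < n) \sum_(j < n) \sum_(k < n) \sum_(l < n)
      (N i j)%:~R * (N k l)%:~R * Z (pr i j) (pr k l).
  by do 4 apply: sum_linear => ?; rewrite !mxE; ring.
ring.
Qed.

Lemma qap_lhs_perm_sq beta N (s : 'S_n) :
  let x : R := \sum_i (N i (s i))%:~R in
  qap_lhs beta N (perm_sq R n s) = x ^+ 2 - (2 * beta%:~R - 1) * x.
Proof.
move=> x; pose p i j : R := (s i == j)%:R.
have pE i j k l : perm_sq R n s (pr i j) (pr k l) = p i j * p k l.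
  by rewrite mxE !mxvecE !mxE.
have xE : \sum_(i < n) \sum_(j < n) (N i j)%:~R * p i j = x.
  apply: eq_bigr => i _; rewrite (bigD1 (s i)) //= big1 => [|j ji].
    by rewrite /p eqxx mulr1 addr0.
  by rewrite /p eq_sym (negbTE ji) mulr0.
rewrite /qap_lhs; congr (_ - _ * _).
  (* The entries of the vertex are products, so the quadratic form is the square of [x]. *)
  transitivity (\sum_(i < n) \sum_(j < n) (N i j)%:~R * p i j * x).
    apply: eq_bigr => i _; apply: eq_bigr => j _; rewrite -xE mulr_sumr.
    apply: eq_bigr => k _; rewrite mulr_sumr.
    by apply: eq_bigr => l _; rewrite pE mulrACA.
  by under eq_bigr do rewrite -mulr_suml; rewrite -mulr_suml xE.
(* A diagonal entry is the square of a 0/1 entry, hence equal to it. *)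
rewrite -xE; apply: eq_bigr => i _; apply: eq_bigr => j _; rewrite pE.
by rewrite /p; case: (_ == _); rewrite ?mulr1 ?mulr0.
Qed.

Definition shift_mx m (a : seq bool) (i j : 'I_n) : int :=
  (nth false a i && (j == i + m :> nat))%N.

(* For beta = 2 the slack is x ^+ 2 - 3 * x + 2 = (x - 1) * (x - 2), which is
   positive for disjoint sets and zero for sets meeting in one element. *)
Lemma qap_lhs_card_meet m b : size b = m -> (m + m <= n)%N ->
  exists s : 'S_n, forall a, size a = m ->
  let x : R := (card_meet a b)%:R in
  qap_lhs 2 (shift_mx m a) (perm_sq R n s) = x ^+ 2 - 3 * x.
Proof.
move=> sb mn; have [s sE] := swap_perm_ex sb mn; exists s => a sa x.
rewrite qap_lhs_perm_sq; set y := \sum_i _.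
suff -> : y = x by congr (_ - _ * _); rewrite -[2%:~R]/(2 : R); ring.
rewrite /x -(@card_meetE n) ?sa //; last by lia.
rewrite natr_sum; apply: eq_bigr => i _; rewrite /shift_mx sE -pmulrn.
congr (nat_of_bool _)%:R; case ai: (nth false a i) => //=.
rewrite /swap_nat; case: (nth false b i); first by rewrite eqxx.
have im : (i < m)%N by rewrite -sa ltnNge; apply: contraTN ai => /(nth_default false)->.
by case: ifP => _; apply/eqP; lia.
Qed.

End QapInequalities.

(** * From extensions to rectangle covers *)

Lemma extension_size_lower_bound (R : realType) n m (Rn : set 'M[R]_(n * n)) k :
  (m + m <= n)%N -> QAP R n `<=` Rn ->
  (forall (beta : int) (N : 'I_n -> 'I_n -> int) (Y : 'M[R]_(n * n)),
     Rn Y -> qap_ineq beta N Y) ->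
  extension_sizes Rn k -> (3 ^ m <= k.+1 * 2 ^ m)%N.
Proof.
move=> mn QR ineq [r [Q [[polyQ RE] nbQ]]].
(* [z b] lifts the vertex of [b] to [Q]; it is 0 when [b] has the wrong size. *)
have /choice[z zP] : forall b, exists z : 'M[R]_(n * n) * 'rV[R]_r,
    size b = m -> Q z /\ forall a, size a = m ->
      let x : R := (card_meet a b)%:R in
      qap_lhs 2 (shift_mx m a) z.1 = x ^+ 2 - 3 * x.
  move=> b; have [sb|nsb] := eqVneq (size b) m; last first.
    by exists 0 => sb; rewrite sb eqxx in nsb.
  have [s sP] := qap_lhs_card_meet R sb mn.
  have : Rn (perm_sq R n s) by apply/QR/mem_conv; exists s.
  by rewrite RE => -[y Qy]; exists (perm_sq R n s, y).
have /choice[f fE] : forall a, exists f : {scalar ('M[R]_(n * n) * 'rV[R]_r)%type},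
    forall u, f u = - qap_lhs 2 (shift_mx m a) u.1.
  move=> a; apply: scalar_ex => c u v.
  by rewrite /= qap_lhs_linear opprD mulrN.
(* For [beta = 2] the right-hand side is 1/4 - (3/2)^2 = -2. *)
have f_le a u : Q u -> f a u <= 2.
  case: u => Y y Qy; rewrite fE /=.
  have /(ineq 2 (shift_mx m a)) : Rn Y by rewrite RE; exists y.
  rewrite /qap_ineq -/(qap_lhs _ _ _) -[2%:~R]/(2 : R); lra.
have fz a b : size a = m -> size b = m ->
    f a (z b) = 3 * (card_meet a b)%:R - (card_meet a b)%:R ^+ 2.
  by move=> sa sb; rewrite fE (zP b sb).2 // opprB.
pose G a := Q `&` [set u | f a u = 2].
have faceG a : face Q (G a) by apply: face_max => u; exact: f_le.
have : ([set F | facet Q F] #<= `I_k)%card by rewrite (card_le_eql nbQ) card_lexx.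
move=> /pcard_surjP[e eP].
(* The last rectangle takes care of the empty a, for which G a is empty. *)
pose A (i : 'I_k.+1) a :=
  if i == k :> nat then ~~ has id a else `[< G a `<=` e i >].
pose B (i : 'I_k.+1) b := (i == k :> nat) || `[< ~ e i (z b) >].
apply: (@disjoint_pairs_cover m k.+1 A B) => [i a b sa sb|a b sa sb ab0].
  rewrite /A /B; case: eqP => /= _; first by move=> /card_meet0->.
  (* One common element gives the value 3 - 1 = 2, so [z b] lies in [G a]. *)
  move=> /asboolP Gi /asboolP nei; apply/eqP => ab1; apply/nei/Gi.
  by split; [exact: (zP b sb).1 | rewrite /= fz // ab1 expr1n mulr1; ring].
have [ha|ha] := boolP (has id a); last by exists ord_max; rewrite /A /B /= eqxx ha.
have Gneq0 : G a !=set0.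
  have [c sc ac] := exists_card_meet1 ha; rewrite sa in sc; exists (z c).
  by split; [exact: (zP c sc).1 | rewrite /= fz // ac expr1n mulr1; ring].
have nGb : ~ G a (z b).
  by move=> [_ /=]; rewrite fz // ab0 => /eqP; rewrite mulr0 expr0n subr0 eq_sym
    pnatr_eq0.
have [F [facetF GF nFb]] := facet_separation polyQ (faceG a) Gneq0 (zP b sb).1 nGb.
have [i ik eiF] := eP F facetF.
have ik1 : (i < k.+1)%N by rewrite ltnS ltnW.
exists (Ordinal ik1); rewrite /A /B /= ltn_eqF //= eiF.
by apply/andP; split; apply/asboolP.
Qed.

Theorem theorem6 (R : realType) :
  exists (c : R) (n0 : nat), 0 < c /\
    forall (n : nat) (Rn : set 'M[R]_(n * n)),
      (n0 <= n)%N ->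
      polytope Rn ->
      QAP R n `<=` Rn ->
      (forall (beta : int) (N : 'I_n -> 'I_n -> int) (Y : 'M[R]_(n * n)),
         Rn Y -> qap_ineq beta N Y) ->
      2 `^ (c * n%:R) <= (xc Rn)%:R.
Proof.
(* With [m = 2 * q] and [q = n %/ 4] the bound reached is 2^(q-1), and q - 1 >= n/8 once n >= 16. *)
exists 8^-1, 16%N; split=> [|n Rn n16 polyR QR ineq]; first by rewrite invr_gt0.
pose q := (n %/ 4)%N.
have qn : (q * 2 + q * 2 <= n)%N by rewrite /q; lia.
have := extension_size_lower_bound qn QR ineq (xcP polyR).
rewrite mulnC !expnM => lb.
(* 9^q <= (xc + 1) 4^q, and 9^q >= 2^q 4^q. *)
have {lb} lb : (2 ^ q <= (xc Rn).+1)%N.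
  have : (2 ^ q * 4 ^ q <= (xc Rn).+1 * 4 ^ q)%N.
    by rewrite -expnMn; apply: leq_trans lb; rewrite leq_exp2r //; lia.
  by rewrite leq_pmul2r // expn_gt0.
(* Halving absorbs the extra rectangle, since 2^(q-1) >= 1. *)
have lb' : (2 ^ q.-1 <= xc Rn)%N.
  have q0 : (1 < q)%N by rewrite /q; lia.
  have : (0 < 2 ^ q.-1)%N by rewrite expn_gt0.
  by move: lb; rewrite -[q in (2 ^ q)%N](ltn_predK q0) expnS; lia.
apply: (@le_trans _ _ ((2 ^ q.-1)%N%:R)); last by rewrite ler_nat.
rewrite natrX -powR_mulrn // ler_powR ?ler1n // mulrC ler_pdivrMr //.
by rewrite -natrM ler_nat /q; lia.
Qed.
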